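(* Let $p$ be an integer with $|p|=2m+1$, where $m\in\mathbb{N}=\{1,2,3,\dots\}$, and let $\varepsilon\in\mathbb{R}$. Let $A=\begin{bmatrix} p&0\\0&p\end{bmatrix}$ and $$\mathcal{D}_\varepsilon=\left\{\begin{bmatrix} i+b_j\\ j\end{bmatrix}:\ b_j=\frac{1-(-1)^j}{2}\,\varepsilon,\quad i,j\in\{0,\pm1,\dots,\pm m\}\right\}\subset\mathbb{R}^2,$$ and let $T_\varepsilon$ be the self-similar set generated by $(A,\mathcal{D}_\varepsilon)$. Put $\mathcal{D}_{\varepsilon,k}=\mathcal{D}_\varepsilon+A\mathcal{D}_\varepsilon+\cdots+A^{k-1}\mathcal{D}_\varepsilon$ for $k\ge1$ and $\mathcal{D}_{\varepsilon,\infty}=\bigcup_{k=1}^\infty\mathcal{D}_{\varepsilon,k}$. Then $T_\varepsilon+\mathcal{D}_{\varepsilon,\infty}$ is a quasi-periodic tiling (of $\mathbb{R}^2$) if and only if $\varepsilon$ is a rational number.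
   Context: The self-similar set generated by $(A,\mathcal{D})$ (with $A$ an expanding similarity and $\mathcal{D}$ a finite digit set) is the unique nonempty compact set $T$ with $T=A^{-1}(T+\mathcal{D})=\bigcup_{d\in\mathcal{D}}A^{-1}(T+d)$. For a compact set $T\subset\mathbb{R}^n$ with nonempty interior and a discrete set $\mathcal{J}\subset\mathbb{R}^n$, $T+\mathcal{J}$ is a tiling of $\mathbb{R}^n$ if $T+\mathcal{J}=\mathbb{R}^n$ and $(T^\circ+t)\cap(T^\circ+t')=\emptyset$ for all distinct $t,t'\in\mathcal{J}$. A tiling $T+\mathcal{J}$ of $\mathbb{R}^n$ is a quasi-periodic tiling if both of the following hold: (1) Local isomorphism property: for any finite set $\Sigma\subset\mathcal{J}$ there exists a constant $R>0$ such that every ball of radius $R$ in $\mathbb{R}^n$ contains a translated copy $\Sigma+t$ of $\Sigma$ with $\Sigma+t\subset\mathcal{J}$. (2) Local finiteness property: for any integer $k\ge1$ and any $r>0$, there are, up to translation, only finitely many arrangements of $k$ points of $\mathcal{J}$ which lie in some ball of radius $r$ (i.e. the $k$-point subsets of $\mathcal{J}$ contained in some ball of radius $r$ fall into finitely many translation classes). *)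

(* Defs.v *)
From HB Require Import structures.
From mathcomp Require Import all_boot all_order all_algebra.
From mathcomp Require Import all_classical all_reals all_analysis.

Set Implicit Arguments.
Unset Strict Implicit.
Unset Printing Implicit Defensive.

Import Order.TTheory GRing.Theory Num.Theory.
Import numFieldNormedType.Exports.

Local Open Scope classical_set_scope.
Local Open Scope ring_scope.

Definition translate (V : zmodType) (S : set V) (t : V) : set V :=
  [set x + t | x in S].

Definition minkowski_sum (V : zmodType) (S S' : set V) : set V :=
  [set x + y | x in S & y in S'].

(* The topology on ['cV[R]_n] is the usual one, but the library's [ball] is
   the sup-norm ball; balls here are Euclidean. *)
Definition euclidean_ball (R : realType) (n : nat) (c : 'cV[R]_n) (r : R) :
    set 'cV[R]_n :=
  [set x | Num.sqrt (\sum_(i < n) (x i 0 - c i 0) ^+ 2) < r].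

Definition is_self_similar_set (R : realType) (n : nat) (A : 'M[R]_n)
    (D : set 'cV[R]_n) (T : set 'cV[R]_n) : Prop :=
  [/\ T !=set0, compact T &
      T = [set invmx A *m x | x in minkowski_sum T D]].

Definition digit_sums (R : realType) (n : nat) (A : 'M[R]_n)
    (D : set 'cV[R]_n) (k : nat) : set 'cV[R]_n :=
  [set \sum_(l < k) A ^+ l *m d l | d in [set d : 'I_k -> 'cV[R]_n |
                                           forall l, D (d l)]].

Definition all_digit_sums (R : realType) (n : nat) (A : 'M[R]_n)
    (D : set 'cV[R]_n) : set 'cV[R]_n :=
  \bigcup_(k in [set k | (1 <= k)%N]) digit_sums A D k.

Definition is_tiling (R : realType) (n : nat) (T J : set 'cV[R]_n) : Prop :=
  [/\ compact T /\ T° !=set0,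
      J `<=` isolated J (* J is discrete *),
      minkowski_sum T J = [set: 'cV[R]_n] &
      forall t t', J t -> J t' -> t <> t' ->
        translate T° t `&` translate T° t' = set0].

Definition local_isomorphism (R : realType) (n : nat) (J : set 'cV[R]_n) :
    Prop :=
  forall Sigma : set 'cV[R]_n, finite_set Sigma -> Sigma `<=` J ->
    exists2 r : R, 0 < r & forall c : 'cV[R]_n, exists t : 'cV[R]_n,
      translate Sigma t `<=` euclidean_ball c r /\ translate Sigma t `<=` J.

Definition arrangements (R : realType) (n : nat) (J : set 'cV[R]_n)
    (k : nat) (r : R) : set (set 'cV[R]_n) :=
  [set S | [/\ S `<=` J, (S #= `I_k)%card &
               exists c, S `<=` euclidean_ball c r]].

Definition translation_class (V : zmodType) (S : set V) : set (set V) :=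
  range (translate S).

Definition local_finiteness (R : realType) (n : nat) (J : set 'cV[R]_n) :
    Prop :=
  forall (k : nat) (r : R), (1 <= k)%N -> 0 < r ->
    finite_set [set translation_class S | S in arrangements J k r].

Definition is_quasi_periodic_tiling (R : realType) (n : nat)
    (T J : set 'cV[R]_n) : Prop :=
  [/\ is_tiling T J, local_isomorphism J & local_finiteness J].

Definition vec2 (R : realType) (x y : R) : 'cV[R]_2 :=
  \col_(i < 2) [:: x; y]`_i.

Definition digit_shift (R : realType) (eps : R) (j : int) : R :=
  (1 - (-1) ^ j) / 2 * eps.

Definition digits_eps (R : realType) (m : nat) (eps : R) : set 'cV[R]_2 :=
  [set d | exists i j : int, [/\ (`|i| <= m)%N, (`|j| <= m)%N &
             d = vec2 (i%:~R + digit_shift eps j) j%:~R]].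

(* Main.v *)
Require Import Defs.
From HB Require Import structures.
From mathcomp Require Import all_boot all_order all_algebra.
From mathcomp Require Import all_classical all_reals all_analysis.
From mathcomp Require Import zify ring lra.
Import Order.TTheory GRing.Theory Num.Theory.
Import numFieldNormedType.Exports.
Local Open Scope classical_set_scope.
Local Open Scope ring_scope.

Set Implicit Arguments.
Unset Strict Implicit.

(** Write q = |p| = 2m + 1 and J for the set of all digit sums.  Every integer
is y = p y' + j with |j| <= m in exactly one way, so it has a unique expansion
in base p with balanced digits.  Let g(y) = odd_sum y be the sum of the p^l
over the positions l that carry an odd digit.  As the two coordinates of a
digit sum are expanded independently, J is the set of the points
(X + eps g(y), y) with X and y integers (all_digit_sumsE).

The first two properties below hold for every eps; the third decides between
rational and irrational.

- T + J is a tiling.  From T = A^-1 (T + D) and J = D + A J, the set S = T + J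
satisfies A^-1 S <= S.  It meets every box of some fixed size, hence it is
dense after contraction (cover_dense), and it is closed because J is locally
finite; so S is the plane, and T has an interior point by Baire's theorem.
For the disjointness of interiors no description of T is needed. If z is in T
and |z_y| > 1/2, then applying z |-> A z - d repeatedly makes |z_y| - 1/2 grow
geometrically, which compactness of T forbids (tile_strip). In the same way
two points of T with a common irrational ordinate have abscissas at most 1
apart, because irrationality forces the digits subtracted from both at each
step to have the same ordinate (tile_slice). Two translates with overlapping
interiors would share a point with irrational ordinate, in contradiction with
these two bounds.

- Local isomorphism holds since g(p^N w + y) = p^N g(w) + g(y) when y has at
most N digits (odd_sum_shift): a finite part of J reappears, translated, near
every point.

- Local finiteness.  If eps = a/b then J is contained in the lattice
(1/b)Z x Z, so a pattern of bounded size is, up to translation, a subset of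
one finite set.  Conversely, for every n there is y with
g(y + 1) - g(y) = p^n (odd_sum_gap), so J contains two points that differ by
(eps p^n + X, 1) with 0 <= eps p^n + X < 1.  If only finitely many of these
differences are distinct, then eps (p^n - p^n') is an integer for some
n <> n', and eps is rational. *)

(** * Balanced expansions of integers *)

Section Balanced.
Variables (m : nat) (p : int).
Hypothesis m_gt0 : (0 < m)%N.
Hypothesis absp : `|p|%N = (2 * m + 1)%N.

(** Quotient and remainder of the division by [p] with balanced remainder,
    that is, of absolute value at most [m]. *)
Definition bquo (y : int) : int := ((y + m%:Z) %/ p)%Z.

Definition brem (y : int) : int := ((y + m%:Z) %% p)%Z - m%:Z.

Lemma bdivE y : y = p * bquo y + brem y.
Proof.
have := divz_eq (y + m%:Z) p; rewrite /bquo /brem.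
set a := divz _ _; set b := modz _ _.
lia.
Qed.

Lemma abs_brem y : (`|brem y| <= m)%N.
Proof.
have p0 : p != 0 by lia.
have := modz_ge0 (y + m%:Z) p0; have := ltz_mod (y + m%:Z) p0.
rewrite /brem; set b := modz _ _; lia.
Qed.

Lemma bdiv_unique y j y' j' : (`|j| <= m)%N -> (`|j'| <= m)%N ->
  p * y + j = p * y' + j' -> y = y' /\ j = j'.
Proof.
move=> jm j'm e.
have e1 : p * (y - y') = j' - j by lia.
have [e0|ne0] := eqVneq y y'; first by subst; split => //; lia.
suff : (absz p <= absz (p * (y - y'))%R)%N by rewrite e1; lia.
rewrite abszM leq_pmulr //; lia.
Qed.

Lemma bquoM y j : (`|j| <= m)%N -> bquo (p * y + j) = y.
Proof.
move=> jm.
by have [] := @bdiv_unique _ _ y j (abs_brem _) jm (esym (bdivE (p * y + j))).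
Qed.

Lemma bremM y j : (`|j| <= m)%N -> brem (p * y + j) = j.
Proof.
move=> jm.
by have [] := @bdiv_unique _ _ y j (abs_brem _) jm (esym (bdivE (p * y + j))).
Qed.

Lemma abs_bquo n y : (`|y| <= n.+1)%N -> (`|bquo y| <= n)%N.
Proof.
move=> yn; have r := abs_brem y; have e := bdivE y.
rewrite leqNgt; apply/negP => q.
have : (absz (p * bquo y)%R <= `|y| + m)%N by lia.
rewrite abszM absp; nia.
Qed.

(** The sum of the [p ^+ l] over the positions [l < n] at which the balanced
    base-[p] expansion of [y] has an odd digit. *)
Fixpoint odd_sum_rec (n : nat) (y : int) : int :=
  if n is n'.+1 then p * odd_sum_rec n' (bquo y) + (odd `|brem y|)%:Z else 0.

(** The same sum over all positions; [`|y|] digits are always enough. *)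
Definition odd_sum (y : int) : int := odd_sum_rec `|y| y.

Lemma brem0 : brem 0 = 0.
Proof. by have := @bremM 0 0 isT; rewrite mulr0 addr0. Qed.

Lemma odd_sum_recS n y : (`|y| <= n)%N -> odd_sum_rec n.+1 y = odd_sum_rec n y.
Proof.
elim: n y => [|n IH] y yn.
  have -> : y = 0 by lia.
  by rewrite /= brem0 mulr0.
have /IH := abs_bquo yn.
move=> e; rewrite [LHS]/=.
by rewrite -[RHS]/(p * odd_sum_rec n (bquo y) + (odd `|brem y|)%:Z) -e.
Qed.

Lemma odd_sum_recE n y : (`|y| <= n)%N -> odd_sum_rec n y = odd_sum y.
Proof.
elim: n => [|n IH] yn; first by have -> : y = 0 by lia.
move: yn; rewrite leq_eqVlt => /orP[/eqP <- //|yn].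
by rewrite odd_sum_recS // IH.
Qed.

Lemma odd_sumM y j : (`|j| <= m)%N ->
  odd_sum (p * y + j) = p * odd_sum y + (odd `|j|)%:Z.
Proof.
move=> jm; set z := p * y + j.
have yz : (`|y| <= (`|z|))%N.
  have [->//|y0] := eqVneq y 0.
  have : (absz (p * y)%R <= `|z| + m)%N by rewrite /z; lia.
  rewrite abszM absp; nia.
by rewrite -(@odd_sum_recE `|z|.+1) //= bquoM // bremM // odd_sum_recE.
Qed.

Lemma odd_sum0 : odd_sum 0 = 0. Proof. by []. Qed.

(** Induction on the number of digits. *)
Lemma bdiv_ind (P : int -> Prop) : P 0 ->
  (forall y j, (`|j| <= m)%N -> P y -> P (p * y + j)) -> forall y, P y.
Proof.
move=> P0 PS y; have [n] := ubnPleq `|y|%N.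
elim: n y => [|n IH] y yn; first by have -> : y = 0 by lia.
rewrite (bdivE y); apply: PS; first exact: abs_brem.
exact/IH/abs_bquo.
Qed.

Lemma odd_sumN y : odd_sum (- y) = odd_sum y.
Proof.
elim/bdiv_ind: y => [|y j jm IH]; first by rewrite oppr0.
have -> : - (p * y + j) = p * (- y) + - j by ring.
by rewrite !odd_sumM ?abszN // IH.
Qed.

(** Expansions of which the lower one occupies only the first [N] positions
    can be juxtaposed; [`|y| <= N] is a crude bound for that. *)
Lemma odd_sum_shift N y w : (`|y| <= N)%N ->
  odd_sum (p ^+ N * w + y) = p ^+ N * odd_sum w + odd_sum y.
Proof.
elim: N y => [|N IH] y yN.
  have -> : y = 0 by lia.
  by rewrite !addr0 !mul1r.
have := odd_sumM (bquo y) (abs_brem y); rewrite -bdivE => ->.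
rewrite [in LHS](bdivE y) addrA exprS -mulrA -mulrDr odd_sumM ?abs_brem //.
by rewrite IH ?abs_bquo //; ring.
Qed.

(** A carry through the [n] lowest positions replaces digits [m] or [- m] by
    their opposites, of the same parity, so that only the digit at position [n]
    changes its parity. *)
Lemma odd_sum_gap n : exists y, odd_sum (y + 1) - odd_sum y = p ^+ n.
Proof.
elim: n => [|n [y IH]].
  exists 0; rewrite add0r; have := @odd_sumM 0 1.
  by rewrite mulr0 add0r => ->.
(* [s] is the sign of [p]: as [p * s] is positive, the last digit [m] followed
   by a carry becomes [- m] on top of [s * (y + 1)]. *)
pose s : int := if 0 <= p then 1 else -1.
have sq z : odd_sum (s * z) = odd_sum z.
  by rewrite /s; case: ifP; rewrite ?mul1r // mulN1r odd_sumN.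
have mm : (`|m%:Z| <= m)%N by [].
have mm' : (`|- m%:Z| <= m)%N by rewrite abszN.
exists (p * (s * y) + m%:Z).
have -> : p * (s * y) + m%:Z + 1 = p * (s * (y + 1)) + - m%:Z.
  by rewrite /s; case: ifP => ?; lia.
rewrite !odd_sumM // !sq abszN exprS -IH; ring.
Qed.
End Balanced.

(** * Coordinates in the plane *)

Lemma floor_dist (R : realType) (x : R) : `|(Num.floor x)%:~R - x| <= 1.
Proof.
have := floor_le x; have := floorD1_gt x; rewrite rmorphD /= => *.
by rewrite ler_norml; lra.
Qed.

Lemma abs_le_truncn (R : realType) (u : int) (C : R) : `|u%:~R| <= C ->
  (`|u| <= (Num.truncn C).+1)%N.
Proof.
move=> h; have := le_lt_trans h (truncnS_gt _).
by rewrite -intr_norm -pmulrn ltr_nat => /ltnW.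
Qed.

Section Vec2.
Context {R : realType}.
Implicit Types (x y : R) (z : 'cV[R]_2).

Lemma vec2E0 x y : vec2 x y 0 0 = x. Proof. by rewrite mxE. Qed.

Lemma vec2E1 x y : vec2 x y 1 0 = y. Proof. by rewrite mxE. Qed.

Lemma forall_ord2 (P : 'I_2 -> Prop) : P 0 -> P 1 -> forall i, P i.
Proof.
move=> P0 P1 [[|[|//]] i2].
  by rewrite (_ : Ordinal i2 = 0) //; apply: val_inj.
by rewrite (_ : Ordinal i2 = 1) //; apply: val_inj.
Qed.

Lemma cV2P z z' : z 0 0 = z' 0 0 -> z 1 0 = z' 1 0 -> z = z'.
Proof.
by move=> e0 e1; apply/matrixP => i j; rewrite ord1; elim/forall_ord2: i.
Qed.

Lemma vec2D x y x' y' : vec2 x y + vec2 x' y' = vec2 (x + x') (y + y').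
Proof. by apply: cV2P; rewrite mxE !(vec2E0, vec2E1). Qed.

Lemma addvec2E0 z x y : (z + vec2 x y) 0 0 = z 0 0 + x.
Proof. by rewrite mxE vec2E0. Qed.

Lemma addvec2E1 z x y : (z + vec2 x y) 1 0 = z 1 0 + y.
Proof. by rewrite mxE vec2E1. Qed.

Lemma vec2N x y : - vec2 x y = vec2 (- x) (- y).
Proof. by apply: cV2P; rewrite mxE !(vec2E0, vec2E1). Qed.

Lemma vec2Z (a x y : R) : a *: vec2 x y = vec2 (a * x) (a * y).
Proof. by apply: cV2P; rewrite mxE !(vec2E0, vec2E1). Qed.

Lemma digit_shiftE (eps : R) (j : int) :
  digit_shift eps j = eps * (odd `|j|)%:R.
Proof.
rewrite /digit_shift.
have -> : (-1) ^ j = (-1) ^+ (odd `|j|) :> R.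
  case: j => n; first by rewrite -exprnP signr_odd.
  by rewrite NegzE -exprz_inv invrN1 -exprnP abszN absz_nat signr_odd.
by case: odd; rewrite ?expr1 ?expr0 ?mulr1n ?mulr0n ?mulr1 ?mulr0; field.
Qed.

Lemma euclidean_ball_box (c z : 'cV[R]_2) (B : R) : 0 <= B ->
  (forall i, `|z i 0 - c i 0| <= B) -> euclidean_ball c (2 * B + 1) z.
Proof.
move=> B0 H; rewrite /euclidean_ball /= big_ord_recl big_ord1.
rewrite -[ltRHS]gtr0_norm; last lra.
rewrite -sqrtr_sqr ltr_sqrt; last by rewrite exprn_gt0 //; lra.
have h i : (z i 0 - c i 0) ^+ 2 <= B ^+ 2.
  by rewrite -real_normK ?num_real // lerXn2r ?nnegrE.
have := h ord0; have := h (lift ord0 ord0); nra.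
Qed.

Lemma euclidean_ball_coord (c z : 'cV[R]_2) (r : R) i :
  euclidean_ball c r z -> `|z i 0 - c i 0| < r.
Proof.
rewrite /euclidean_ball /=; apply: le_lt_trans.
rewrite -sqrtr_sqr ler_wsqrtr // (bigD1 i) //= lerDl.
by apply: sumr_ge0 => ? _; exact: sqr_ge0.
Qed.

End Vec2.

(** * The set of all digit sums *)

Lemma digit_sums0 (R : realType) n (A : 'M[R]_n) D : digit_sums A D 0 0.
Proof. by exists (fun=> 0); [case | rewrite big_ord0]. Qed.

Lemma digit_sumsS (R : realType) n (A : 'M[R]_n) D k t :
  digit_sums A D k.+1 t <->
  exists d t', [/\ D d, digit_sums A D k t' & t = d + A *m t'].
Proof.
split=> [[d Dd <-]|[d [_ [Dd [e De <-] ->]]]].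
  exists (d ord0), (\sum_(l < k) A ^+ l *m d (lift ord0 l)); split => //.
    by exists (fun l => d (lift ord0 l)).
  rewrite big_ord_recl expr0 mul1mx mulmx_sumr; congr (_ + _).
  by apply: eq_bigr => l _; rewrite /= exprS mulmxA.
exists (fun l => if unlift ord0 l is Some l' then e l' else d).
  by move=> l /=; case: unlift.
rewrite big_ord_recl unlift_none expr0 mul1mx mulmx_sumr; congr (_ + _).
by apply: eq_bigr => l _; rewrite liftK /= exprS mulmxA.
Qed.

Section Lattice.
Variables (R : realType) (p : int) (m : nat) (eps : R).
Hypothesis m_gt0 : (0 < m)%N.
Hypothesis absp : `|p|%N = (2 * m + 1)%N.
Let A : 'M[R]_2 := (p%:~R)%:M.
Let D := digits_eps m eps.

(** The digit sum whose indices [i] and [j], weighted by the powers of [p], add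
    up to [X] and [y]; the shifts of its digits add up to
    [eps * odd_sum m p y]. *)
Definition sum_pt (X y : int) : 'cV[R]_2 :=
  vec2 (X%:~R + eps * (odd_sum m p y)%:~R) y%:~R.

Lemma sum_pt0 : sum_pt 0 0 = 0.
Proof. by apply: cV2P; rewrite !(vec2E0, vec2E1) mxE // mulr0 addr0. Qed.

(** The digit with indices [i] and [j]. *)
Definition digit_pt (i j : int) : 'cV[R]_2 :=
  vec2 (i%:~R + digit_shift eps j) j%:~R.

Lemma sum_ptM X y i j : (`|j| <= m)%N ->
  sum_pt (p * X + i) (p * y + j) = digit_pt i j + p%:~R *: sum_pt X y.
Proof.
move=> jm; rewrite /sum_pt odd_sumM // /digit_pt digit_shiftE vec2Z vec2D.
by congr vec2; rewrite !(rmorphD, rmorphM) /=; [rewrite -pmulrn; ring|ring].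
Qed.

Lemma digit_sums_sum_pt k t :
  digit_sums A D k t -> exists X y, t = sum_pt X y.
Proof.
elim: k t => [_ [? _ <-]|k IH t].
  by exists 0, 0; rewrite big_ord0 sum_pt0.
move=> /digit_sumsS[_ [_ [[i [j [im jm ->]] /IH[X [y ->]] ->]]]].
by exists (p * X + i), (p * y + j); rewrite sum_ptM // mul_scalar_mx.
Qed.

Lemma sum_pt_digit_sums k X y : (`|X| <= k)%N -> (`|y| <= k)%N ->
  digit_sums A D k (sum_pt X y).
Proof.
elim: k X y => [|k IH] X y Xk yk.
  have -> : X = 0 by lia. have -> : y = 0 by lia.
  rewrite sum_pt0; exact: digit_sums0.
apply/digit_sumsS; exists (digit_pt (brem m p X) (brem m p y)).
exists (sum_pt (bquo m p X) (bquo m p y)); split.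
- by exists (brem m p X), (brem m p y); split => //; exact: abs_brem.
- by apply: IH; exact: abs_bquo.
- by rewrite mul_scalar_mx -sum_ptM ?abs_brem // -!bdivE.
Qed.

Lemma all_digit_sumsE :
  all_digit_sums A D = [set t | exists X y, t = sum_pt X y].
Proof.
apply/seteqP; split => [t [k _ /digit_sums_sum_pt //]|t [X [y ->]]].
by exists (maxn `|X| `|y|).+1 => //; apply: sum_pt_digit_sums; lia.
Qed.

Lemma sum_pt_div X y : exists i j X' y', [/\ (`|i| <= m)%N, (`|j| <= m)%N &
  sum_pt X y = digit_pt i j + p%:~R *: sum_pt X' y'].
Proof.
exists (brem m p X), (brem m p y), (bquo m p X), (bquo m p y).
by split; rewrite ?abs_brem // -sum_ptM ?abs_brem // -!bdivE.
Qed.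

(** Digit sums are relatively dense. *)
Lemma sum_pt_near (z : 'cV[R]_2) :
  exists X y, forall i, `|sum_pt X y i 0 - z i 0| <= 1.
Proof.
pose y := Num.floor (z 1 0).
pose X := Num.floor (z 0 0 - eps * (odd_sum m p y)%:~R).
exists X, y.
elim/forall_ord2; rewrite /sum_pt ?vec2E0 ?vec2E1 //; last exact: floor_dist.
have := floor_dist (z 0 0 - eps * (odd_sum m p y)%:~R).
by rewrite -/X opprB addrA addrC addrA [_ + X%:~R]addrC.
Qed.

(** Digit sums are uniformly discrete. *)
Lemma sum_pt_dist X y X' y' :
  (forall i, `|sum_pt X y i 0 - sum_pt X' y' i 0| < 1) ->
  sum_pt X y = sum_pt X' y'.
Proof.
have h (a b : int) : `|(a%:~R : R) - b%:~R| < 1 -> a = b.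
  rewrite -rmorphB -intr_norm -[1]/(1%:~R) ltr_int; lia.
move=> H; move: (H 1); rewrite /sum_pt !vec2E1 => /h e1; subst y'.
have := H 0; rewrite !vec2E0 opprD addrACA subrr addr0 => /h -> //.
Qed.

End Lattice.

(** * Finiteness, boundedness and translates *)

Lemma finite_powerset (T : eqType) (A : set T) :
  finite_set A -> finite_set [set B | B `<=` A].
Proof.
move=> /finite_seqP[s ->].
pose f (U : {set 'I_(size s)}) :=
  [set x | exists2 i, i \in U & tnth (in_tuple s) i = x].
apply: (@sub_finite_set _ _ (range f)); last exact/finite_image/finite_finset.
move=> B Bs; exists [set i | `[< B (tnth (in_tuple s) i) >]]%SET => //.
apply/seteqP; split => [x [i + <-]|x Bx]; first by rewrite inE => /asboolP.
have /tnthP[i xi] : x \in in_tuple s by exact: (Bs x Bx).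
by exists i; rewrite // inE -xi; exact/asboolP.
Qed.

Lemma finite_abs_le (N : nat) : finite_set [set n : int | (`|n| <= N)%N].
Proof.
apply: (@sub_finite_set _ _ ((fun k : nat => k%:Z - N%:Z) @` `I_(2 * N + 1))).
  by move=> n /= nN; exists (absz (n + N%:Z)%R) => /=; lia.
exact/finite_image/finite_II.
Qed.

Lemma compact_coord_bounded (R : realType) (T : set 'cV[R]_2) : compact T ->
  exists2 B : R, 0 <= B & forall z, T z -> forall i, `|z i 0| <= B.
Proof.
move=> /compact_bounded /pinfty_ex_gt0[B B0 HB]; exists B; first exact: ltW.
move=> z Tz i; apply: le_trans (HB _ Tz).
rewrite [leRHS]/Num.Def.normr /= mx_normrE.
exact: (le_bigmax _ (fun ij : 'I_2 * 'I_1 => `|z ij.1 ij.2|) (i, 0)).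
Qed.

Lemma translateD (V : zmodType) (S : set V) s t :
  translate (translate S s) t = translate S (s + t).
Proof.
apply/seteqP; split => [_ [_ [z Sz <-] <-]|_ [z Sz <-]].
  by exists z; rewrite // addrA.
by exists (z + s); [exists z|rewrite addrA].
Qed.

Lemma translation_class_translate (V : zmodType) (S : set V) s :
  translation_class (translate S s) = translation_class S.
Proof.
apply/seteqP; split => _ [t _ <-]; first by exists (s + t); rewrite // translateD.
by exists (t - s); rewrite // translateD addrC subrK.
Qed.

(** * Quasi-periodicity of the set of digit sums *)

Section QuasiPeriodic.
Variables (R : realType) (p : int) (m : nat) (eps : R).
Hypothesis m_gt0 : (0 < m)%N.
Hypothesis absp : `|p|%N = (2 * m + 1)%N.
Let J : set 'cV[R]_2 := [set t | exists X y, t = sum_pt p m eps X y].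

Lemma sum_pt_local_isomorphism : local_isomorphism J.
Proof.
move=> Sigma finS SJ.
have [B B0 HB] := compact_coord_bounded (finite_compact finS).
pose N := (Num.truncn B).+1.
have BN : B < N%:R by exact: truncnS_gt.
pose P : R := `|p%:~R ^+ N|.
have P1 : 1 <= P.
  rewrite /P normrX exprn_ege1 // -intr_norm -[1]/(1%:~R) ler_int; lia.
have pN0 : p%:~R ^+ N != 0 :> R by rewrite -normr_gt0 -/P (lt_le_trans ltr01).
exists (2 * (P + B) + 1); first by lra.
move=> c.
(* Translating by [sum_pt X y] with [y = p ^+ N * w] keeps the set of digit sums
   around [Sigma]; the integers [w] and [X] are free and bring the
   copy near [c]. *)
pose w := Num.floor (c 1 0 / p%:~R ^+ N).
pose y := p ^+ N * w.
pose X := Num.floor (c 0 0 - eps * (odd_sum m p y)%:~R).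
exists (sum_pt p m eps X y); split=> _ [z Sz <-]; last first.
  have [X0 [y0 z0]] := SJ z Sz.
  exists (X0 + X), (y + y0).
  have y0N : (`|y0| <= N)%N.
    have := HB z Sz 1; rewrite z0 vec2E1 => /le_lt_trans/(_ BN).
    by rewrite -intr_norm -pmulrn ltr_nat; lia.
  have hs v : (`|v| <= N)%N ->
      odd_sum m p (y + v) = p ^+ N * odd_sum m p w + odd_sum m p v.
    by move=> vN; rewrite /y odd_sum_shift.
  have := hs 0 (leq0n _); rewrite addr0 odd_sum0 addr0 => ys.
  rewrite z0 /sum_pt vec2D hs // ys !rmorphD /=; congr vec2; ring.
apply: euclidean_ball_box; first lra.
move=> i; rewrite mxE -addrA; apply: (le_trans (ler_normD _ _)).
rewrite [leRHS]addrC lerD ?HB //.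
rewrite /sum_pt; elim/forall_ord2: i.
- rewrite vec2E0; apply: le_trans P1.
  have := floor_dist (c 0 0 - eps * (odd_sum m p y)%:~R); rewrite -/X.
  by congr (`|_| <= _); ring.
- rewrite vec2E1 /y rmorphM rmorphXn /=.
  rewrite (_ : _ - _ = p%:~R ^+ N * (w%:~R - c 1 0 / p%:~R ^+ N)); last by field.
  by rewrite normrM ler_piMr //; exact: floor_dist.
Qed.

Lemma sum_pt_local_finiteness : rational eps -> local_finiteness J.
Proof.
move=> [q _ qeps] k r k1 r0.
have d0 : (denq q)%:~R != 0 :> R by rewrite intr_eq0 denq_neq0.
pose b := denq q.
have Jb z : J z -> exists u v : int, z = vec2 (u%:~R / b%:~R) v%:~R.
  move=> [X [y ->]]; exists (X * b + numq q * odd_sum m p y), y.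
  rewrite /sum_pt -qeps /ratr rmorphD !rmorphM /=; congr vec2.
  by rewrite /b; field; exact: d0.
pose N := (Num.truncn (2 * r * `|b%:~R|)).+1.
have hN (u : int) : `|u%:~R| < 2 * r * `|b%:~R| -> (`|u| <= N)%N.
  by move=> /ltW/abs_le_truncn.
pose F : set 'cV[R]_2 := [set vec2 (u%:~R / b%:~R) v%:~R |
  u in [set n : int | (`|n| <= N)%N] & v in [set n : int | (`|n| <= N)%N]].
have finF : finite_set F by apply: finite_image2; exact: finite_abs_le.
apply: (@sub_finite_set _ _
  [set translation_class B | B in [set B : set 'cV[R]_2 | B `<=` F]]); last first.
  exact/finite_image/finite_powerset.
move=> _ [S [SJ Sk [c Sc]] <-].
have [s Ss] : S !=set0.
  apply/set0P/eqP => S0; move: Sk; rewrite S0 => /card_eqPle[_].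
  rewrite card_le0; case/eqP/seteqP => + _; move/(_ 0%N); exact.
(* Up to translation the pattern contains the origin, so that it lies in [F]. *)
exists (translate S (- s)).
  move=> _ [z Sz <-].
  have [u [v zE]] := Jb _ (SJ _ Sz); have [u' [v' sE]] := Jb _ (SJ _ Ss).
  have dist i : `|z i 0 - s i 0| < 2 * r.
    have := euclidean_ball_coord i (Sc _ Sz).
    have := euclidean_ball_coord i (Sc _ Ss).
    rewrite !ltr_norml => /andP[? ?] /andP[? ?]; lra.
  exists (u - u') => /=.
    apply: hN; have := dist 0; rewrite zE sE !vec2E0 -mulrBl -rmorphB normrM normfV.
    by rewrite ltr_pdivrMr // normr_gt0.
  exists (v - v') => /=.
    apply: hN; have := dist 1; rewrite zE sE !vec2E1 -rmorphB => /lt_le_trans -> //.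
    rewrite ler_peMr //; first lra.
    rewrite -intr_norm -[1]/(1%:~R) ler_int /b; have := denq_gt0 q; lia.
  by rewrite zE sE vec2N vec2D -mulNr -!rmorphN -mulrDl -!rmorphD.
exact: translation_class_translate.
Qed.

Lemma sum_pt_local_finiteness_rational : local_finiteness J -> rational eps.
Proof.
move=> lf; apply: contrapT => irr.
have /choice[Y HY] := odd_sum_gap m_gt0 absp.
(* [X n] brings the abscissas of the two points of the pair within distance 1. *)
pose X n : int := - Num.floor (eps * p%:~R ^+ n).
pose t n := sum_pt p m eps 0 (Y n); pose u n := sum_pt p m eps (X n) (Y n + 1).
have utE n : u n 0 0 - t n 0 0 = (X n)%:~R + eps * p%:~R ^+ n.
  rewrite /u /t /sum_pt !vec2E0 -rmorphXn -HY rmorphB /=; ring.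
have tE n : t n 1 0 = (Y n)%:~R by rewrite vec2E1.
have uE n : u n 1 0 = (Y n)%:~R + 1 by rewrite vec2E1 rmorphD.
have tu n : t n <> u n.
  by move=> /(congr1 (fun z : 'cV[R]_2 => z 1 0)); rewrite tE uE; lra.
pose f n := translation_class [set t n; u n].
have fin : finite_set [set translation_class S | S in arrangements J 2 3].
  by apply: lf => //; lra.
have sub : f @^-1` [set translation_class S | S in arrangements J 2 3] = setT.
  apply/seteqP; split=> // n _; exists [set t n; u n] => //; split.
  - by move=> _ [->|->]; [exists 0, (Y n)|exists (X n), (Y n + 1)].
  - apply/eq_cardSP; exists (u n); first by right.
    rewrite (_ : _ `\` _ = [set t n]) ?card_set1 //.
    apply/seteqP; split => [z [[//|->] /(_ erefl)] //|_ ->].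
    by split; [left|exact: tu].
  - exists (t n) => _ [->|->].
      rewrite (_ : 3 = 2 * 1 + 1); last by ring.
      by apply: euclidean_ball_box => // i; rewrite subrr normr0.
    rewrite (_ : 3 = 2 * 1 + 1); last by ring.
    apply: euclidean_ball_box => //; elim/forall_ord2; last first.
      by rewrite tE uE addrAC subrr add0r normr1.
    rewrite utE /X rmorphN /= addrC.
    have := floor_le (eps * p%:~R ^+ n); have := floorD1_gt (eps * p%:~R ^+ n).
    by rewrite rmorphD /= ler_norml; lra.
apply: infinite_nat; rewrite -sub; apply: finite_preimage fin.
move=> n n' _ _; rewrite /f => fnn'; apply: contrapT => nn'; apply: irr.
have [v _ vE] : translation_class [set t n'; u n'] [set t n; u n].
  rewrite -fnn'; exists 0 => //.
  apply/seteqP; split => [_ [z tuz <-]|z tuz]; first by rewrite addr0.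
  by exists z; rewrite ?addr0.
have /= t'v : [set t n; u n] (t n' + v) by rewrite -vE; exists (t n') => //; left.
have /= u'v : [set t n; u n] (u n' + v) by rewrite -vE; exists (u n') => //; right.
(* The ordinates of both pairs differ by 1, so the translation respects the
   order in the pairs. *)
have {t'v u'v} [t'v u'v] : t n' + v = t n /\ u n' + v = u n.
  have h z z' : z + v = z' -> z 1 0 + v 1 0 = z' 1 0 by move=> <-; rewrite mxE.
  case: t'v u'v => t'v [] u'v //; move: (h _ _ t'v) (h _ _ u'v);
    by rewrite !(tE, uE); clear => ? ?; exfalso; lra.
have e : (X n)%:~R + eps * p%:~R ^+ n = (X n')%:~R + eps * p%:~R ^+ n' :> R.
  by rewrite -!utE -t'v -u'v !mxE; ring.
pose a := X n' - X n; pose b := p ^+ n - p ^+ n'.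
have b0 : b != 0.
  rewrite subr_eq0; apply/eqP => /(congr1 absz); rewrite !abszX.
  by move/eqP; rewrite eqn_exp2l ?absp; [move/eqP|lia].
exists (a%:~R / b%:~R) => //; rewrite fmorph_div /= !ratr_int.
have b0' : b%:~R != 0 :> R by rewrite intr_eq0.
apply: (mulIf b0'); rewrite divfK // /a /b !rmorphB !rmorphXn /= mulrBr; lra.
Qed.
End QuasiPeriodic.

(** * Topology of the plane *)

(** Nonempty matrices over the reals form a complete normed module, being
    complete and normed; Baire's theorem is stated for such modules. *)
HB.instance Definition _ (R : realType) (m n : nat) :=
  NormedModule.on 'M[R]_(m.+1, n.+1).

Lemma nbhs_boxP (R : realType) (z : 'cV[R]_2) (U : set 'cV[R]_2) : nbhs z U <->
  exists2 e : R, 0 < e &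
    forall z' : 'cV[R]_2, (forall i, `|z' i 0 - z i 0| < e) -> U z'.
Proof.
split=> [/nbhs_ballP[e e0 zU]|[e e0 zU]].
  exists e => // z' h; apply: zU; split => // i j.
  by rewrite ord1 -ball_normE /= distrC; exact: h.
apply/nbhs_ballP; exists e => // z' h; apply: zU => i.
by have [_ /(_ i 0)] := h; rewrite -ball_normE /= distrC.
Qed.

Lemma compact_translate_closed (R : realType) (T : set 'cV[R]_2) t :
  compact T -> closed (translate T t).
Proof.
move=> cT; apply: compact_closed; first exact: norm_hausdorff.
apply: (@continuous_compact _ _ (fun x => x + t)) => //.
apply: continuous_subspaceT => x.
apply: (@cvgD _ _ _ (nbhs x) _ id (cst t) x t).
  exact: cvg_id.
exact: cvg_cst.
Qed.

Lemma irrational_near (R : realType) (x e : R) : 0 < e ->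
  exists2 s, `|s| < e & ~ rational (x + s).
Proof.
move=> e0; have [[q _ xq]|irr] := pselect (rational x); last first.
  by exists 0; rewrite ?normr0 ?addr0.
pose n := (Num.truncn (pi / e)).+1.
have n0 : 0 < n%:R :> R by rewrite ltr0n.
exists (pi / n%:R).
  rewrite ger0_norm ?divr_ge0 ?pi_ge0 ?ler0n // ltr_pdivrMr //.
  by rewrite mulrC -ltr_pdivrMr //; exact: truncnS_gt.
move=> [r _ re]; apply: (@pi_irrationnal R); exists ((r - q) * n%:R) => //.
by rewrite rmorphM rmorphB /= ratr_nat re xq; field; rewrite gt_eqF.
Qed.

(** If from every number of a bounded set [P] that exceeds [c] in absolute
    value one reaches another number of [P] whose excess over [c] is at least
    twice as large, then there are no such numbers. *)
Lemma expansive_bound (R : realType) (P : R -> Prop) (B c : R) :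
  (forall x, P x -> `|x| <= B) ->
  (forall x, P x -> c < `|x| ->
    exists2 x', P x' & 2 * (`|x| - c) <= `|x'| - c) ->
  forall x, P x -> `|x| <= c.
Proof.
move=> PB PS x Px; rewrite leNgt; apply/negP => cx.
have iter k : exists x', [/\ P x', c < `|x'| & 2 ^+ k * (`|x| - c) <= `|x'| - c].
  elim: k => [|k [x' [Px' cx' kx']]]; first by exists x; rewrite mul1r.
  have [x'' Px'' le''] := PS _ Px' cx'; exists x''; split => //; first lra.
  by rewrite exprS -mulrA; apply: le_trans le''; rewrite ler_pM2l.
pose k := (Num.truncn ((B - c) / (`|x| - c))).+1.
have [x' [Px' _]] := iter k; apply/negP; rewrite -ltNge.
have xc : 0 < `|x| - c by rewrite subr_gt0.
apply: (@le_lt_trans _ _ (B - c)); first by rewrite lerD2r PB.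
rewrite -ltr_pdivrMr //; apply: lt_le_trans (truncnS_gt _) _.
by rewrite -/k -natrX ler_nat; apply/ltnW/ltn_expl.
Qed.

(** The excess over [c] is multiplied by at least [2 * M + 1 >= 2] by an
    expansion of ratio [2 * M + 1] followed by a shift of at most [2 * M * c]. *)
Lemma expansion_step (R : realType) (M a a' c : R) : 1 <= M -> c < a ->
  (2 * M + 1) * a <= a' + 2 * M * c -> 2 * (a - c) <= a' - c.
Proof. by move=> M1 ca h; nra. Qed.

(** * The tiling *)

Section Tile.
Variables (R : realType) (p : int) (m : nat) (eps : R) (T : set 'cV[R]_2).
Hypothesis m_gt0 : (0 < m)%N.
Hypothesis absp : `|p|%N = (2 * m + 1)%N.
Let A : 'M[R]_2 := (p%:~R)%:M.
Let D := digits_eps m eps.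
Hypothesis selfT : is_self_similar_set A D T.
Let J : set 'cV[R]_2 := [set t | exists X y, t = sum_pt p m eps X y].
Let P : R := p%:~R.

Let cT : compact T. Proof. by case: selfT. Qed.

Let P_neq0 : P != 0.
Proof. rewrite intr_eq0; lia. Qed.

Let normP : `|P| = 2 * m%:R + 1.
Proof.
by rewrite -intr_norm -abszE absp -pmulrn natrD natrM.
Qed.

Let m_ge1 : 1 <= m%:R :> R. Proof. by rewrite ler1n. Qed.

Lemma tile_split z : T z -> exists i j z', [/\ (`|i| <= m)%N, (`|j| <= m)%N,
  T z' & P *: z = z' + digit_pt eps i j].
Proof.
case: selfT => _ _ {1}->; rewrite invmx_scalar.
move=> [_ [z' Tz' [_ [i [j [im jm ->]]] <-]] <-].
by exists i, j, z'; split => //; rewrite mul_scalar_mx scalerA divff // scale1r.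
Qed.

Lemma tile_join i j z : (`|i| <= m)%N -> (`|j| <= m)%N -> T z ->
  T (P^-1 *: (z + digit_pt eps i j)).
Proof.
move=> im jm Tz; case: selfT => _ _ ->; rewrite invmx_scalar.
exists (z + digit_pt eps i j); last by rewrite mul_scalar_mx.
by exists z => //; exists (digit_pt eps i j) => //; exists i, j.
Qed.

Let S := minkowski_sum T J.

(** The covered set [S] is stable under contraction by [p]. *)
Lemma cover_div k z : S z -> S (P ^- k *: z).
Proof.
elim: k z => [|k IH] z; first by rewrite expr0 invr1 scale1r.
move=> [w Tw [_ [X [y ->]] <-]].
have [i [j [X' [y' [im jm ->]]]]] := sum_pt_div eps m_gt0 absp X y.
rewrite exprSr invfM -scalerA; apply: IH.
exists (P^-1 *: (w + digit_pt eps i j)); first exact: tile_join.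
exists (sum_pt p m eps X' y'); first by exists X', y'.
by rewrite addrA [RHS]scalerDr scalerA mulVf // scale1r.
Qed.

(** An element of [S] at bounded distance from [P ^+ k *: z] is contracted to
    an element of [S] near [z]. *)
Lemma cover_dense (z : 'cV[R]_2) (e : R) : 0 < e ->
  exists2 s, S s & forall i, `|s i 0 - z i 0| < e.
Proof.
move=> e0; have [B B0 TB] := compact_coord_bounded cT.
case: selfT => -[w Tw] _ _.
pose k := (Num.truncn ((B + 1) / e)).+1.
have [X [y near_z]] := sum_pt_near p m eps (P ^+ k *: z).
exists (P ^- k *: (w + sum_pt p m eps X y)).
  apply: cover_div; exists w => //.
  by exists (sum_pt p m eps X y) => //; exists X, y.
move=> i; have Pk0 : P ^+ k != 0 by rewrite expf_neq0.
move: (sum_pt p m eps X y) (near_z i) => l {near_z}; rewrite !mxE => near_i.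
rewrite (_ : _ - _ = (w i 0 + (l i 0 - P ^+ k * z i 0)) / P ^+ k); last by field.
rewrite normrM normfV ltr_pdivrMr ?normr_gt0 //.
apply: (@le_lt_trans _ _ (B + 1)).
  by apply: (le_trans (ler_normD _ _)); rewrite lerD // TB.
rewrite mulrC -ltr_pdivrMr //; apply: lt_le_trans (truncnS_gt _) _.
rewrite -/k normrX normP -[1]/(1%:R) -[2]/(2%:R) -natrM -natrD -natrX ler_nat.
by apply: ltnW; apply: ltn_expl; lia.
Qed.

Lemma sum_pt_finite_near (z : 'cV[R]_2) (B : R) :
  finite_set [set t | J t /\ forall i, `|t i 0 - z i 0| <= B].
Proof.
pose Ny := (Num.truncn (`|z 1 0| + B)).+1.
pose NX (y : int) := (Num.truncn (`|z 0 0| + B + `|eps * (odd_sum m p y)%:~R|)).+1.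
apply: (@sub_finite_set _ _ (\bigcup_(y in [set y : int | (`|y| <= Ny)%N])
  ((fun X => sum_pt p m eps X y) @` [set X : int | (`|X| <= NX y)%N]))); last first.
  apply: bigcup_finite; first exact: finite_abs_le.
  by move=> y _; apply/finite_image/finite_abs_le.
move=> _ [[X [y ->]] near_z].
exists y => /=.
  apply: abs_le_truncn; have := near_z 1; rewrite vec2E1 => h.
  rewrite -(subrK (z 1 0) y%:~R) addrC.
  by apply: (le_trans (ler_normD _ _)); rewrite lerD.
exists X => //=; apply: abs_le_truncn; have := near_z 0; rewrite vec2E0.
set g := eps * _ => h.
rewrite (_ : X%:~R = z 0 0 + (X%:~R + g - z 0 0) - g); last by ring.
apply: (le_trans (ler_normB _ _)); rewrite lerD2r.
by apply: (le_trans (ler_normD _ _)); rewrite lerD.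
Qed.

Lemma cover_full : S = setT.
Proof.
apply/seteqP; split => // z _.
have [B B0 TB] := compact_coord_bounded cT.
pose F := [set t | J t /\ forall i, `|t i 0 - z i 0| <= B + 1].
(* Near [z] only the translates of [T] by the finite set [F] matter. *)
have : closed (\bigcup_(t in F) translate T t).
  apply: closed_bigcup; first exact: sum_pt_finite_near.
  by move=> t _; exact: compact_translate_closed.
move=> /(_ z); case.
  move=> U /nbhs_boxP[e e0 zU].
  have e10 : 0 < Num.min e 1 by rewrite lt_min e0 ltr01.
  have [s [w Tw [t Jt wts]] near_z] := cover_dense z e10.
  exists s; split.
    exists t; last by exists w.
    split=> // i; have := near_z i; rewrite -wts mxE lt_min => /andP[_ h].
    rewrite (_ : _ - _ = w i 0 + t i 0 - z i 0 - w i 0); last by ring.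
    apply: (le_trans (ler_normB _ _)); rewrite addrC lerD ?TB //; exact: ltW.
  by apply: zU => i; have := near_z i; rewrite lt_min => /andP[].
by move=> t [Jt _] [w Tw <-]; exists w => //; exists t.
Qed.

Lemma interior_tile_nonempty : T° !=set0.
Proof.
apply: contrapT => /set0P/negP; rewrite negbK => /eqP T0.
(* An enumeration of the digit sums; the default value 0 is harmless. *)
pose t n := if unpickle n is Some Xy then sum_pt p m eps Xy.1 Xy.2 else 0.
have : dense (\bigcap_n ~` translate T (t n)).
  apply: Baire => n; split.
    by apply: closed_openC; exact: compact_translate_closed.
  move=> O [z Oz] openO; apply: contrapT => notd.
  have OT : O `<=` translate T (t n).
    by move=> w Ow; apply: contrapT => nw; apply: notd; exists w.
  have /nbhs_boxP[e e0 zO] : nbhs z O by exact: open_nbhs_nbhs.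
  suff : T° (z - t n) by rewrite T0.
  apply/nbhs_boxP; exists e => // w wz.
  have [|w' Tw' /addIr <- //] := OT (w + t n).
  by apply: zO => i; have := wz i; rewrite !mxE opprB addrA addrAC.
move=> /(_ setT (ex_intro _ 0 I) openT)[z [_ zF]].
have : S z by rewrite cover_full.
move=> [w Tw [_ [X [y ->]] wz]].
apply: (zF (pickle (X, y)) I); exists w => //.
by rewrite /t pickleK.
Qed.

(** The tile lies in a horizontal strip of width 1. *)
Lemma tile_strip z : T z -> `|z 1 0| <= 2^-1.
Proof.
move=> Tz; have [B B0 TB] := compact_coord_bounded cT.
apply: (@expansive_bound _ (fun y => exists2 z, T z & y = z 1 0) B);
  last by exists z.
  by move=> _ [w Tw ->]; exact: TB.
move=> _ [w Tw ->] c; have [i [j [w' [im jm Tw' e]]]] := tile_split Tw.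
exists (w' 1 0); first by exists w'.
have := congr1 (fun v : 'cV[R]_2 => v 1 0) e.
rewrite mxE [in RHS]mxE vec2E1 => e1.
have jm' : `|j%:~R| <= m%:R :> R by rewrite -intr_norm -abszE -pmulrn ler_nat.
have : `|P * w 1 0| <= `|w' 1 0| + m%:R.
  by rewrite e1; apply: (le_trans (ler_normD _ _)); rewrite lerD2l.
rewrite normrM normP => h; apply: (expansion_step m_ge1 c).
by apply: le_trans h _; rewrite mulrAC divff // mul1r.
Qed.

Let rational_div (x : R) (j : int) : rational (P * x - j%:~R) -> rational x.
Proof.
move=> [q _ qe]; exists ((q + j%:~R) / p%:~R) => //.
rewrite fmorph_div rmorphD /= !ratr_int qe subrK -/P; field; exact: P_neq0.
Qed.

(** Only a half-integer can be at distance at most 1/2 from two distinct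
    integers. *)
Lemma strip_unique (x : R) (j j' : int) : ~ rational x ->
  `|x - j%:~R| <= 2^-1 -> `|x - j'%:~R| <= 2^-1 -> j = j'.
Proof.
move=> irr; rewrite !ler_norml => /andP[h1 h2] /andP[h3 h4].
have [//|jj'] := eqVneq j j'; exfalso; apply: irr.
have jj1 : j%:~R - j'%:~R <= 1 :> R by lra.
have jj2 : j'%:~R - j%:~R <= 1 :> R by lra.
move: jj1 jj2; rewrite -!rmorphB -[1]/(1%:~R) !ler_int => jj1 jj2.
have {jj1 jj2} [jE|jE] : j = j' + 1 \/ j' = j + 1 by lia.
  exists (j'%:~R + 2^-1) => //; rewrite rmorphD fmorphV /= ratr_int ratr_nat.
  by move: h1 h2 h3 h4; rewrite jE rmorphD /=; lra.
exists (j%:~R + 2^-1) => //; rewrite rmorphD fmorphV /= ratr_int ratr_nat.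
by move: h1 h2 h3 h4; rewrite jE rmorphD /=; lra.
Qed.

(** The horizontal slices of the tile at irrational heights have diameter at
    most 1. *)
Lemma tile_slice z z' : T z -> T z' -> z 1 0 = z' 1 0 -> ~ rational (z 1 0) ->
  `|z 0 0 - z' 0 0| <= 1.
Proof.
move=> Tz Tz' zz' irr; have [B B0 TB] := compact_coord_bounded cT.
apply: (@expansive_bound _ (fun x => exists z z', [/\ T z, T z', z 1 0 = z' 1 0,
   ~ rational (z 1 0) & x = z 0 0 - z' 0 0]) (B + B)); last by exists z, z'.
  move=> _ [w [w' [Tw Tw' _ _ ->]]].
  by apply: (le_trans (ler_normB _ _)); rewrite lerD ?TB.
move=> _ [w [w' [Tw Tw' ww' wirr ->]]] c {z z' Tz Tz' zz' irr}.
have [i [j [v [im jm Tv e]]]] := tile_split Tw.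
have [i' [j' [v' [i'm j'm Tv' e']]]] := tile_split Tw'.
have := congr1 (fun v : 'cV[R]_2 => v 1 0) e.
rewrite mxE [in RHS]mxE vec2E1 => e1.
have := congr1 (fun v : 'cV[R]_2 => v 1 0) e'.
rewrite mxE [in RHS]mxE vec2E1 => e'1.
have virr : ~ rational (P * w 1 0).
  by move=> h; apply: wirr; apply: (@rational_div _ 0); rewrite subr0.
have jj' : j = j'.
  apply: (strip_unique virr).
    by rewrite e1 addrK; exact: tile_strip.
  by rewrite ww' e'1 addrK; exact: tile_strip.
subst j'.
exists (v 0 0 - v' 0 0).
  exists v, v'; split => //; first by apply: (addIr j%:~R); rewrite -e1 -e'1 ww'.
  by rewrite -(addrK j%:~R (v 1 0)) -e1 => /rational_div.
have := congr1 (fun v : 'cV[R]_2 => v 0 0) e.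
rewrite mxE [in RHS]mxE vec2E0 => e0.
have := congr1 (fun v : 'cV[R]_2 => v 0 0) e'.
rewrite mxE [in RHS]mxE vec2E0 => e'0.
have im' : `|i%:~R - i'%:~R| <= 2 * m%:R :> R.
  rewrite -rmorphB -intr_norm -[2]/(2%:R) -natrM pmulrn ler_int; lia.
have : `|P * (w 0 0 - w' 0 0)| <= `|v 0 0 - v' 0 0| + 2 * m%:R.
  rewrite mulrBr e0 e'0.
  rewrite (_ : _ - _ = (v 0 0 - v' 0 0) + (i%:~R - i'%:~R)); last by ring.
  by apply: (le_trans (ler_normD _ _)); rewrite lerD2l.
rewrite normrM normP => h; apply: (expansion_step m_ge1 c).
by rewrite mulr1.
Qed.

Lemma tile_disjoint t t' : J t -> J t' -> t <> t' ->
  translate T° t `&` translate T° t' = set0.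
Proof.
move=> [X [y ->]] [X' [y' ->]] tt'.
apply/seteqP; split => // _ [[a Ta <-] [a' Ta' e]].
exfalso; apply: tt'.
have [d d0 ad] := (nbhs_boxP a T).1 Ta; have [d' d0' ad'] := (nbhs_boxP a' T).1 Ta'.
have dd0 : 0 < Num.min d d' by rewrite lt_min d0.
(* A vertical shift by [s] makes the ordinate of [a] irrational without leaving
   [T], and likewise keeps [a'] in [T]. *)
have [s] := irrational_near (a 1 0) dd0; rewrite lt_min => /andP[sd sd'] irr.
have := congr1 (fun v : 'cV[R]_2 => v 0 0) e.
rewrite mxE [in RHS]mxE /sum_pt !vec2E0 => e0.
have := congr1 (fun v : 'cV[R]_2 => v 1 0) e.
rewrite mxE [in RHS]mxE /sum_pt !vec2E1 => e1.
have near_T r : `|r| < d -> T (a + vec2 r s).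
  move=> rd; apply: ad => i; rewrite mxE addrAC subrr add0r.
  by elim/forall_ord2: i; rewrite ?vec2E0 ?vec2E1.
have near_T' : T (a' + vec2 0 s).
  apply: ad' => i; rewrite mxE addrAC subrr add0r.
  by elim/forall_ord2: i; rewrite ?vec2E0 ?vec2E1 ?normr0.
have yy' : y = y'.
  have := tile_strip near_T'; have := @near_T 0.
  rewrite normr0 => /(_ d0)/tile_strip.
  rewrite !addvec2E1 => h h'.
  suff : 0 = y' - y by move/esym/subr0_eq.
  apply: (strip_unique irr); first by rewrite subr0.
  by move: h'; congr (`|_| <= _); rewrite rmorphB /=; lra.
subst y'.
have aa' : a 1 0 = a' 1 0 by lra.
have [->//|XX'] := eqVneq X X'; exfalso.
have slice r : `|r| < d -> `|(X'%:~R - X%:~R) + r| <= 1 :> R.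
  move=> rd; have := tile_slice (near_T r rd) near_T'.
  rewrite !(addvec2E0, addvec2E1) addr0 aa'.
  move=> /(_ erefl); rewrite -aa' => /(_ irr); congr (`|_| <= _); lra.
(* A further horizontal shift of [a], by whichever of [d / 2] and [- (d / 2)] has
   the sign of [X' - X], makes the distance of the abscissas exceed 1. *)
have hr : `|d / 2| < d by rewrite ger0_norm; lra.
have hr' : `|- (d / 2)| < d by rewrite normrN.
have := slice _ hr; have := slice _ hr'.
rewrite !ler_norml => /andP[h1 h2] /andP[h3 h4].
have : 1 <= `|X'%:~R - X%:~R| :> R.
  rewrite -rmorphB -intr_norm -[1]/(1%:~R) ler_int.
  by rewrite -gtz0_ge1 normr_gt0 subr_eq0 eq_sym.
by rewrite ler_normr => /orP[]; lra.
Qed.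

Lemma tile_tiling : is_tiling T J.
Proof.
split.
- by split; [exact: cT|exact: interior_tile_nonempty].
- move=> t Jt; split; first exact/mem_set.
  exists [set t' : 'cV[R]_2 | forall i, `|t' i 0 - t i 0| < 1].
    by apply/nbhs_boxP; exists 1.
  apply/seteqP; split => [t' [near_t Jt']|_ -> /=]; last first.
    by split => // i; rewrite subrr normr0.
  move: Jt Jt' near_t => [X [y ->]] [X' [y' ->]]; exact: sum_pt_dist.
- exact: cover_full.
- exact: tile_disjoint.
Qed.
End Tile.

Theorem theorem1p2 (R : realType) (p : int) (m : nat) (eps : R)
    (T : set 'cV[R]_2) :
  (1 <= m)%N -> `|p|%N = (2 * m + 1)%N ->
  let A : 'M[R]_2 := (p%:~R)%:M in
  let D := digits_eps m eps in
  is_self_similar_set A D T ->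
  is_quasi_periodic_tiling T (all_digit_sums A D) <-> rational eps.
Proof.
move=> m_gt0 absp A D selfT; rewrite all_digit_sumsE //; split.
  by case=> _ _; exact: sum_pt_local_finiteness_rational.
move=> rat_eps; split; first exact: tile_tiling.
- exact: sum_pt_local_isomorphism.
- exact: sum_pt_local_finiteness.
Qed.
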